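(* Suppose that $m_\Delta\notin H(\mathfrak K)$. Then \[ \frac{\mathcal A_q^{(4)}}{\mathcal A_q^{(F)}}\longrightarrow1,\qquad q\to\infty, \] equivalently, $\mathcal A_q^{(4)}\sim\mathcal A_q^{(F)}$ as $q\to\infty$.
   Context: Let $H=L^2([0,1])$ (real) with its usual inner product. For $f,g\in H$, $f\otimes g$ is the rank-one operator $(f\otimes g)(h)=\langle h,g\rangle f$. Let $X_\ell\sim\mathbb G(m_\ell,\mathsf K)$, $\ell=1,2$, be Gaussian random elements of $H$ with means $m_1,m_2\in H$ and common covariance operator $\mathsf K$ induced by a continuous covariance kernel $\mathfrak K$; $\mathsf K$ is self-adjoint, positive and trace class. Fix an orthonormal basis $\{\gamma_j\}_{j\ge1}$ of $H$ with $\mathsf K\gamma_j=\lambda_j\gamma_j$, $\lambda_1\ge\lambda_2\ge\cdots$, and assume $\lambda_j>0$ for all $j$. Let $m_\Delta=m_2-m_1=\sum_j\nu_j\gamma_j$ and $\widetilde\nu_j=\nu_j/\sqrt{\lambda_j}$. The Cameron--Martin space of $\mathsf K$ is \[ H(\mathfrak K)=\Bigl\{f=\sum_{j\ge1}f_j\gamma_j\in H:\ \sum_{j\ge1}f_j^2/\lambda_j<\infty\Bigr\}. \] Fix $0<\alpha<1$ and set $\rho=\alpha(1-\alpha)$, $\pi_1=\alpha$, $\pi_2=1-\alpha$, $a_1=-(1-\alpha)$, $a_2=\alpha$. Let $\zeta_{\ell j}=\langle X_\ell-m_\ell,\gamma_j\rangle_H/\sqrt{\lambda_j}$; for each $\ell$,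 these are independent standard Gaussian variables. For $q\ge1$ define \[ \widetilde{\mathsf V}^{(2)}_{\ell,q}=\sum_{j,k=1}^{q}\bigl(\zeta_{\ell j}\zeta_{\ell k}+a_\ell^2\widetilde\nu_j\widetilde\nu_k\bigr)(\gamma_j\otimes\gamma_k), \] \[ \widetilde{\mathsf V}_q^{(4)}=\sum_{\ell=1}^2\pi_\ell\,\mathbb E\bigl(\widetilde{\mathsf V}^{(2)}_{\ell,q}\otimes\widetilde{\mathsf V}^{(2)}_{\ell,q}\bigr),\qquad \mathsf F_q=\sum_{\ell=1}^2\pi_\ell\,\bigl(\mathbb E\widetilde{\mathsf V}^{(2)}_{\ell,q}\bigr)\otimes\bigl(\mathbb E\widetilde{\mathsf V}^{(2)}_{\ell,q}\bigr). \] Let $\kappa_{j,q}$ and $\kappa^{(F)}_{j,q}$ ($1\le j\le q$) be the completely diagonal coefficients of $\widetilde{\mathsf V}_q^{(4)}$ and $\mathsf F_q$, i.e. the coefficients of $\gamma_j\otimes\gamma_j\otimes\gamma_j\otimes\gamma_j$: \[ \kappa_{j,q}=\sum_{\ell=1}^2\pi_\ell\,\mathbb E\bigl[(\zeta_{\ell j}^2+a_\ell^2\widetilde\nu_j^{\,2})^2\bigr],\qquad \kappa^{(F)}_{j,q}=\sum_{\ell=1}^2\pi_\ell\,\bigl(\mathbb E[\zeta_{\ell j}^2+a_\ell^2\widetilde\nu_j^{\,2}]\bigr)^2 . \] The aggregated spectral functionals are \[ \mathcal A_q^{(4)}=3+\sum_{j=1}^q(\kappa_{j,q}-3),\qquad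 \mathcal A_q^{(F)}=1+\sum_{j=1}^q(\kappa^{(F)}_{j,q}-1). \] For sequences, $x_q\sim y_q$ means $x_q/y_q\to1$ as $q\to\infty$. *)

(* Defs.v *)
From HB Require Import structures.
From mathcomp Require Import all_boot all_order all_algebra.
From mathcomp Require Import all_classical all_reals all_analysis.

Set Implicit Arguments.
Unset Strict Implicit.
Unset Printing Implicit Defensive.
Import Order.TTheory GRing.Theory Num.Theory.
Import numFieldNormedType.Exports.
Local Open Scope classical_set_scope.
Local Open Scope ring_scope.

Definition lebesgue01 (R : realType) : {measure set (measurableTypeR R) -> \bar R} :=
  mrestr (@lebesgue_measure R) (measurable_itv `[0%R, 1%R]).

(** L^2([0,1]): its elements are represented by square-integrable functions
    [f : R -> R], of which only the restriction to [0,1] matters; equality in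
    L^2 is [f = g %[ae lebesgue01 R]].  Every notion below is invariant under
    a.e. equality of its L^2 arguments. *)
Definition L2 (R : realType) := LfunType (lebesgue01 R) (lee1n 2).

Definition inner (R : realType) (f g : L2 R) : R :=
  \int[lebesgue01 R]_x (f x * g x).

Definition rank_one (R : realType) (f g : L2 R) : L2 R -> L2 R :=
  fun h => inner h g *: f.

Definition orthonormal_basis (R : realType) (e : nat -> L2 R) : Prop :=
  (forall i j, inner (e i) (e j) = (i == j)%:R) /\
  (forall f : L2 R,
     'N[lebesgue01 R]_2%:E
       [EFin \o (f - \sum_(j < n) inner f (e j) *: e j : L2 R)%R]%E
       @[n --> \oo] --> (0 : \bar R)).

Definition covariance_kernel (R : realType) (k : R -> R -> R) : Prop :=
  [/\ {within `[0, 1] `*` `[0, 1], continuous (fun x : R * R => k x.1 x.2)},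
      forall s t, s \in `[0, 1] -> t \in `[0, 1] -> k s t = k t s
    & forall (n : nat) (t c : 'I_n -> R), (forall i, t i \in `[0, 1]) ->
        0 <= \sum_i \sum_j c i * c j * k (t i) (t j)].

Definition induced_by (R : realType) (K : L2 R -> L2 R) (k : R -> R -> R) :=
  forall f : L2 R,
    (K f : R -> R) = (fun s => \int[lebesgue01 R]_t (k s t * f t))
    %[ae lebesgue01 R].

Definition self_adjoint (R : realType) (K : L2 R -> L2 R) : Prop :=
  forall f g, inner (K f) g = inner f (K g).

Definition positive_op (R : realType) (K : L2 R -> L2 R) : Prop :=
  forall f, 0 <= inner (K f) f.

(** For a positive operator [K] one has [|K| = K], so that being trace class
    amounts to the convergence of the series of diagonal coefficients. *)
Definition trace_class (R : realType) (K : L2 R -> L2 R) : Prop :=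
  forall e, orthonormal_basis e ->
    cvgn (series (fun j => inner (K (e j)) (e j))).

(** Gaussian laws on the line, Dirac masses included.  The case distinction is
    needed because [normal_prob c 0] is the uniform law on [0,1]. *)
Definition gaussian_law (R : realType) (c s : R) (A : set (measurableTypeR R)) :
    \bar R :=
  if s == 0 then \d_c A else normal_prob c s A.

Definition gaussian_rv d (T : measurableType d) (R : realType)
    (P : probability T R) (Y : T -> R) : Prop :=
  measurable_fun [set: T] Y /\
  exists c s : R, forall A : set (measurableTypeR R), measurable A ->
    P (Y @^-1` A) = gaussian_law c s A.

(** [X] is a Gaussian random element of L^2 with mean element [m] and
    covariance operator [K].  Measurability of [X] is expressed through the
    functionals [<X, h>], which generate the Borel sets of the separable
    Hilbert space L^2. *)
Definition gaussian_element d (T : measurableType d) (R : realType)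
    (P : probability T R) (X : T -> L2 R) (m : L2 R) (K : L2 R -> L2 R) : Prop :=
  [/\ forall h, gaussian_rv P (fun w => inner (X w) h),
      forall h, 'E_P[fun w => inner (X w) h]%E = (inner m h)%:E
    & forall f g, covariance P (fun w => inner (X w) f)
                              (fun w => inner (X w) g) = (inner (K f) g)%:E].

Definition cameron_martin (R : realType) (gamma : nat -> L2 R)
    (lambda : nat -> R) : set (L2 R) :=
  [set f | cvgn (series (fun j => inner f (gamma j) ^+ 2 / lambda j))].

(** The two populations are indexed by ['I_2]: [ord0] is the first one and
    [ord_max] the second one.  Eigenpairs are numbered from 0. *)

Definition prior (R : realType) (alpha : R) (l : 'I_2) : R :=
  if l == ord0 then alpha else 1 - alpha.

Definition acoef (R : realType) (alpha : R) (l : 'I_2) : R :=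
  if l == ord0 then - (1 - alpha) else alpha.

Definition mean_diff (R : realType) (m : 'I_2 -> L2 R) : L2 R :=
  m ord_max - m ord0.

Definition nu_tilde (R : realType) (gamma : nat -> L2 R) (lambda : nat -> R)
    (m : 'I_2 -> L2 R) (j : nat) : R :=
  inner (mean_diff m) (gamma j) / Num.sqrt (lambda j).

Definition zeta (T : Type) (R : realType) (gamma : nat -> L2 R)
    (lambda : nat -> R) (m : 'I_2 -> L2 R) (X : 'I_2 -> T -> L2 R)
    (l : 'I_2) (j : nat) (w : T) : R :=
  inner (X l w - m l) (gamma j) / Num.sqrt (lambda j).

Definition V2 (T : Type) (R : realType) (gamma : nat -> L2 R)
    (lambda : nat -> R) (m : 'I_2 -> L2 R) (X : 'I_2 -> T -> L2 R) (alpha : R)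
    (l : 'I_2) (q : nat) (w : T) : L2 R -> L2 R :=
  fun h => \sum_(j < q) \sum_(k < q)
    (zeta gamma lambda m X l j w * zeta gamma lambda m X l k w
     + acoef alpha l ^+ 2 * nu_tilde gamma lambda m j * nu_tilde gamma lambda m k)
    *: rank_one (gamma j) (gamma k) h.

(** Coefficient of [gamma j (x) gamma k] in the expansion of the operator [A]:
    its Hilbert-Schmidt inner product with [rank_one (gamma j) (gamma k)]. *)
Definition coef (R : realType) (gamma : nat -> L2 R) (A : L2 R -> L2 R)
    (j k : nat) : R :=
  inner (A (gamma k)) (gamma j).

(** The tensors V^(4)_q and F_q lie in the span of the
    [gamma i1 (x) gamma i2 (x) gamma i3 (x) gamma i4] with indices below [q].
    They are given by their coefficients in this orthonormal system; the
    expectation of a random tensor is taken coefficientwise ([fine] is harmless: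
    the coefficients are polynomials in Gaussian variables). *)
Definition V4_coef d (T : measurableType d) (R : realType)
    (P : probability T R) (gamma : nat -> L2 R) (lambda : nat -> R)
    (m : 'I_2 -> L2 R) (X : 'I_2 -> T -> L2 R) (alpha : R) (q : nat)
    (i1 i2 i3 i4 : 'I_q) : R :=
  \sum_(l < 2) prior alpha l *
    fine 'E_P[fun w => coef gamma (V2 gamma lambda m X alpha l q w) i1 i2
                     * coef gamma (V2 gamma lambda m X alpha l q w) i3 i4].

Definition F_coef d (T : measurableType d) (R : realType)
    (P : probability T R) (gamma : nat -> L2 R) (lambda : nat -> R)
    (m : 'I_2 -> L2 R) (X : 'I_2 -> T -> L2 R) (alpha : R) (q : nat)
    (i1 i2 i3 i4 : 'I_q) : R :=
  \sum_(l < 2) prior alpha l *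
    (fine 'E_P[fun w => coef gamma (V2 gamma lambda m X alpha l q w) i1 i2] *
     fine 'E_P[fun w => coef gamma (V2 gamma lambda m X alpha l q w) i3 i4]).

Definition kappa d (T : measurableType d) (R : realType)
    (P : probability T R) (gamma : nat -> L2 R) (lambda : nat -> R)
    (m : 'I_2 -> L2 R) (X : 'I_2 -> T -> L2 R) (alpha : R) (q : nat)
    (j : 'I_q) : R :=
  V4_coef P gamma lambda m X alpha j j j j.

Definition kappaF d (T : measurableType d) (R : realType)
    (P : probability T R) (gamma : nat -> L2 R) (lambda : nat -> R)
    (m : 'I_2 -> L2 R) (X : 'I_2 -> T -> L2 R) (alpha : R) (q : nat)
    (j : 'I_q) : R :=
  F_coef P gamma lambda m X alpha j j j j.

Lemma inner_integrable (R : realType) (f g : L2 R) :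
  (lebesgue01 R).-integrable [set: _] (EFin \o (fun x => f x * g x)).
Proof.
apply/Lfun1_integrable; apply: Lfun2_mul_Lfun1; exact: LfunP.
Qed.

Lemma innerDl (R : realType) (f g h : L2 R) :
  inner (f + g) h = inner f h + inner g h.
Proof.
rewrite /inner -RintegralD//; try exact: inner_integrable.
by apply: eq_Rintegral => x _; rewrite mulrDl.
Qed.

Lemma innerZl (R : realType) (a : R) (f h : L2 R) :
  inner (a *: f) h = a * inner f h.
Proof.
rewrite /inner -RintegralZl//; try exact: inner_integrable.
by apply: eq_Rintegral => x _; rewrite mulrA.
Qed.

Lemma inner_suml (R : realType) n (F : 'I_n -> L2 R) (h : L2 R) :
  inner (\sum_(i < n) F i) h = \sum_(i < n) inner (F i) h.
Proof.
have h0 : inner 0 h = 0 by rewrite -(scale0r (0 : L2 R)) innerZl mul0r.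
elim: n F => [|n IH] F; first by rewrite !big_ord0.
by rewrite !big_ord_recr/= innerDl IH.
Qed.

Lemma coef_V2 (T : Type) (R : realType) (gamma : nat -> L2 R)
    (lambda : nat -> R) (m : 'I_2 -> L2 R) (X : 'I_2 -> T -> L2 R) (alpha : R)
    (l : 'I_2) (q : nat) (w : T) (j k : 'I_q) :
  orthonormal_basis gamma ->
  coef gamma (V2 gamma lambda m X alpha l q w) j k =
  zeta gamma lambda m X l j w * zeta gamma lambda m X l k w
  + acoef alpha l ^+ 2 * nu_tilde gamma lambda m j * nu_tilde gamma lambda m k.
Proof.
move=> [og _]; rewrite /coef /V2 inner_suml (bigD1 j)//= inner_suml.
rewrite (bigD1 k)//= !(innerZl, og, eqxx, mulr1).
rewrite !big1 ?addr0//.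
- move=> i ij; rewrite inner_suml big1// => i' _.
  have ij0 : (i == j :> nat) = false by exact: negbTE.
  by rewrite !(innerZl, og) ij0 !mulr0.
- move=> i ik; have ik0 : (k == i :> nat) = false by rewrite eq_sym; exact: negbTE.
  by rewrite !(innerZl, og) ik0 mul0r mulr0.
Qed.

(** Explicit form of the completely diagonal coefficients. *)
Lemma kappaE d (T : measurableType d) (R : realType)
    (P : probability T R) (gamma : nat -> L2 R) (lambda : nat -> R)
    (m : 'I_2 -> L2 R) (X : 'I_2 -> T -> L2 R) (alpha : R) (q : nat)
    (j : 'I_q) : orthonormal_basis gamma ->
  kappa P gamma lambda m X alpha j =
  \sum_(l < 2) prior alpha l *
    fine 'E_P[fun w => (zeta gamma lambda m X l j w ^+ 2
      + acoef alpha l ^+ 2 * nu_tilde gamma lambda m j ^+ 2) ^+ 2].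
Proof.
move=> og; apply: eq_bigr => l _; congr (_ * fine 'E_P[_]).
by apply/funext => w; rewrite !coef_V2// -mulrA -!expr2.
Qed.

Lemma kappaFE d (T : measurableType d) (R : realType)
    (P : probability T R) (gamma : nat -> L2 R) (lambda : nat -> R)
    (m : 'I_2 -> L2 R) (X : 'I_2 -> T -> L2 R) (alpha : R) (q : nat)
    (j : 'I_q) : orthonormal_basis gamma ->
  kappaF P gamma lambda m X alpha j =
  \sum_(l < 2) prior alpha l *
    (fine 'E_P[fun w => zeta gamma lambda m X l j w ^+ 2
      + acoef alpha l ^+ 2 * nu_tilde gamma lambda m j ^+ 2]) ^+ 2.
Proof.
move=> og; apply: eq_bigr => l _; rewrite -expr2; congr (_ * fine 'E_P[_] ^+ 2).
by apply/funext => w; rewrite !coef_V2// -mulrA -!expr2.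
Qed.

Definition A4 d (T : measurableType d) (R : realType)
    (P : probability T R) (gamma : nat -> L2 R) (lambda : nat -> R)
    (m : 'I_2 -> L2 R) (X : 'I_2 -> T -> L2 R) (alpha : R) (q : nat) : R :=
  3 + \sum_(j < q) (kappa P gamma lambda m X alpha j - 3).

Definition AF d (T : measurableType d) (R : realType)
    (P : probability T R) (gamma : nat -> L2 R) (lambda : nat -> R)
    (m : 'I_2 -> L2 R) (X : 'I_2 -> T -> L2 R) (alpha : R) (q : nat) : R :=
  1 + \sum_(j < q) (kappaF P gamma lambda m X alpha j - 1).

(* Main.v *)
Require Import Defs.
From mathcomp Require Import all_boot all_order all_algebra.
From mathcomp Require Import all_classical all_reals all_analysis.
From mathcomp Require Import measurable_realfun ring.
Import Order.TTheory GRing.Theory Num.Theory.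
Import numFieldNormedType.Exports.
Local Open Scope classical_set_scope.
Local Open Scope ring_scope.

(** Since [zeta_lj] is standard Gaussian, [E (zeta^2 + b)^2 = 3 + 2b + b^2] and
    [(E (zeta^2 + b))^2 = 1 + 2b + b^2].  Hence [kappa_j - 3] and [kappaF_j - 1]
    are the same number [t_j], and the two functionals are [3 + S_q] and
    [1 + S_q] with the same partial sum [S_q] of [t].  As
    [t_j >= 2 alpha (1 - alpha) nu_tilde_j^2], [S_q] tends to infinity as soon
    as the mean difference is outside the Cameron-Martin space. *)

(** * Integrals against the normal law: density, integration by parts, moments *)

(** The Radon-Nikodym derivative of [normal_prob] and [normal_pdf] have the same integral over every
    measurable set, so they agree almost everywhere. As [f] is nonnegative, both sides make sense in
    the extended reals. *)
Lemma ge0_integral_normal_prob (R : realType) (c s : R) (f : R -> R) :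
  measurable_fun setT f -> (forall x, 0 <= f x) ->
  (\int[normal_prob c s]_x (f x)%:E =
   \int[lebesgue_measure]_x (f x * normal_pdf c s x)%:E)%E.
Proof.
move=> mf f0.
pose mu : {sigma_finite_measure set (measurableTypeR R) -> \bar R} :=
  @lebesgue_measure R.
pose nu : {finite_measure set (measurableTypeR R) -> \bar R} := normal_prob c s.
have numu : nu `<< mu := normal_prob_dominates c s.
have mfE : measurable_fun setT (fun x : R => (f x)%:E) by exact/measurable_EFinP.
have -> : (\int[normal_prob c s]_x (f x)%:E = \int[nu]_x (f x)%:E)%E by [].
rewrite -(Radon_Nikodym_SigmaFinite.change_of_variables numu)//.
have mg := measurable_int _ (Radon_Nikodym_SigmaFinite.f_integrable numu).
have mh : measurable_fun setT (fun x => (normal_pdf c s x)%:E).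
  by apply/measurable_EFinP; exact: measurable_normal_pdf.
under [RHS]eq_integral do rewrite EFinM.
apply: ae_eq_integral => //.
- exact: emeasurable_funM.
- exact: emeasurable_funM.
- apply: ae_eqe_mul2l.
  apply: integral_ae_eq => //.
    exact: Radon_Nikodym_SigmaFinite.f_integrable.
  by move=> E _ mE; rewrite -Radon_Nikodym_SigmaFinite.f_integral.
Qed.

(** On a bounded symmetric interval the two integrals differ by the boundary values of [F], which
    vanish in the limit; monotone convergence passes to the whole line, because [f] and [g] are each
    nonnegative. *)
Lemma ge0_integral_eq_FTC (R : realType) (f g F : R -> R) :
  continuous f -> continuous g ->
  (forall x, 0 <= f x) -> (forall x, 0 <= g x) ->
  (forall x : R, is_derive x (1 : R) F (f x - g x)) ->
  F n%:R @[n --> \oo] --> 0 -> F (- n%:R) @[n --> \oo] --> 0 ->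
  (\int[lebesgue_measure]_x (f x)%:E = \int[lebesgue_measure]_x (g x)%:E)%E.
Proof.
move=> cf cg f0 g0 dF Fy FNy.
have cF : continuous F.
  by move=> x; apply/differentiable_continuous/derivable1_diffP; have [] := dF x.
(* The shift to [n.+1] keeps the interval nondegenerate at [n = 0], as the fundamental theorem of
   calculus requires. *)
pose D (n : nat) : set R := `[- n.+1%:R, n.+1%:R]%classic.
have ndD : nondecreasing_seq D.
  move=> m n mn; apply/subsetPset/subset_itv; rewrite bnd_simp ?lerN2 ler_nat//.
have cvgI (h : R -> R) : continuous h -> (forall x, 0 <= h x) ->
    (\int[lebesgue_measure]_(x in D n) (h x)%:E)%E @[n --> \oo] -->
    (\int[lebesgue_measure]_x (h x)%:E)%E.
  move=> ch h0.
  have -> : [set: R] = \bigcup_n D n.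
    apply/esym; rewrite -subTset => x _; exists (Num.bound `|x|) => //.
    have /ltW xb : `|x| < (Num.bound `|x|)%:R by exact: archi_boundP.
    by rewrite /D/= in_itv/= -ler_norml (le_trans xb)// ler_nat.
  apply: ge0_nondecreasing_set_cvg_integral => //.
  - by move=> n; exact: measurable_itv.
  - move=> n; apply/measurable_EFinP/measurable_funTS.
    exact: continuous_measurable_fun.
  - by move=> n x _; rewrite lee_fin.
have FTC n : (\int[lebesgue_measure]_(x in D n) (f x)%:E =
    \int[lebesgue_measure]_(x in D n) (g x)%:E +
    (F n.+1%:R - F (- n.+1%:R))%:E)%E.
  have ch : continuous (f \- g) by move=> x; exact: cvgB (cf x) (cg x).
  have iD (h : R -> R) : continuous h ->
      lebesgue_measure.-integrable (D n) (EFin \o h).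
    move=> chh; apply: continuous_compact_integrable.
      exact: segment_compact.
    exact: continuous_subspaceT.
  have : (\int[lebesgue_measure]_(x in D n) ((f \- g) x)%:E =
      (F n.+1%:R)%:E - (F (- n.+1%:R))%:E)%E.
    apply: continuous_FTC2.
    - by rewrite gtrN.
    - exact: continuous_subspaceT.
    - split.
      + by move=> x _; have [] := dF x.
      + exact: cvg_at_right_filter (cF _).
      + exact: cvg_at_left_filter (cF _).
    - by move=> x _; rewrite derive1E derive_val.
  under eq_integral do rewrite /= EFinB.
  rewrite integralB//=; [|exact: measurable_itv|exact: iD|exact: iD].
  rewrite -EFinB => <-; rewrite addeC subeK//.
  by apply: integrable_fin_num; [exact: measurable_itv|exact: iD].
(* Uniqueness of limits: the truncated integrals of [f] are those of [g] plus a boundary term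
   tending to 0. *)
have := cvgI _ cf f0; under eq_fun do rewrite FTC.
move=> /cvg_unique; apply => //.
rewrite /= -[X in _ --> X]adde0.
apply: cvgeD; [by rewrite fin_num_adde_defl|exact: cvgI|].
apply/cvg_EFin; first by near=> n.
rewrite -[X in _ --> X](subr0 (0:R)); apply: cvgB.
  by rewrite -(cvg_shiftS (fun n => F n%:R)) in Fy.
by rewrite -(cvg_shiftS (fun n => F (- n%:R))) in FNy.
Unshelve. all: by end_near. Qed.

Lemma is_derive_normal_pdf (R : realType) (c s x : R) : s != 0 ->
  is_derive x 1 (normal_pdf c s) (- ((x - c) / s ^+ 2) * normal_pdf c s x).
Proof.
move=> s0; rewrite normal_pdfE//.
(* With the exponent as a polynomial, its derivative is the formal one and the chain rule with
   [expR] applies. *)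
pose p : {poly R} := (- (s ^+ 2 *+ 2)^-1) *: ('X - c%:P) ^+ 2.
have -> : (fun x => normal_peak s * normal_fun c s x) =
    normal_peak s \*: (expR \o horner p).
  apply/funext => y; rewrite /= /normal_fun !(hornerZ, horner_exp, hornerXsubC) mulNr.
  by rewrite /GRing.scale/= mulNr [X in expR (- X)]mulrC.
have dp : is_derive x 1 (horner p) (- ((x - c) / s ^+ 2)).
  apply: is_derive_eq; rewrite /p derivZ deriv_exp derivXsubC.
  rewrite !(hornerZ, hornerMn, hornerM, horner_exp, hornerXsubC, hornerC).
  by rewrite /= expr1; field.
have de := is_derive1_comp (is_derive_expR _) dp.
apply: is_derive_eq; rewrite /GRing.scale/= /normal_fun.
have -> : p.[x] = - (x - c) ^+ 2 / (s ^+ 2 *+ 2).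
  by rewrite !(hornerZ, horner_exp, hornerXsubC); ring.
ring.
Qed.

(* The exponential beats every power: e^y >= y^(k+1)/(k+1)! at y = v^2/(2s^2). *)
Lemma normal_pdf_tail (R : realType) (c s : R) (p : {poly R}) (u : nat -> R) :
  s != 0 -> `|u n - c| @[n --> \oo] --> +oo ->
  p.[u n - c] * normal_pdf c s (u n) @[n --> \oo] --> 0.
Proof.
move=> s0 uy.
have tail k : (u n - c) ^+ k * normal_pdf c s (u n) @[n --> \oo] --> 0.
  pose t := s ^+ 2 *+ 2; have t0 : 0 < t by rewrite mulrn_wgt0// exprn_even_gt0.
  (* With [v = |u n - c| >= 1], the exponential bound gives [v^k exp(-v^2/t) <= t^(k+1) (k+1)! v^k /
     v^(2k+2)], and [v^k / v^(2k+2) <= 1/v]. The constants, with the peak of the density, make up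
     [C]. *)
  pose C := normal_peak s * (t ^+ k.+1 * k.+1`!%:R).
  apply: norm_cvg0.
  apply: (@squeeze_cvgr _ _ _ _ (cst 0) (fun n => C * `|u n - c|^-1)); last 2 first.
  - exact: cvg_cst.
  - rewrite -(mulr0 C); apply: cvgMr.
    apply/gtr0_cvgV0 => //; near=> n; rewrite (lt_le_trans ltr01)//.
    by near: n; move/cvgryPge : uy; apply.
  near=> n; have v1 : 1 <= `|u n - c| by near: n; move/cvgryPge : uy; apply.
  rewrite normr_ge0/= normrM normrX.
  rewrite [`|normal_pdf _ _ _|]ger0_norm ?normal_pdf_ge0//.
  rewrite normal_pdfE// /normal_fun -/t.
  set v := `|u n - c| in v1 *.
  have v0 : 0 < v by rewrite (lt_le_trans ltr01).
  have -> : (u n - c) ^+ 2 = v ^+ 2 by rewrite real_normK// num_real.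
  have y0 : 0 <= v ^+ 2 / t by rewrite divr_ge0 ?sqr_ge0 ?ltW.
  have := expR_ge1Dxn k y0; rewrite mulNr expRN.
  set e := expR _ => /(le_trans _) he.
  have e0 : 0 < e by exact: expR_gt0.
  have f0 : (0:R) < k.+1`!%:R by rewrite ltr0n fact_gt0.
  have {}he : (v ^+ 2) ^+ k.+1 <= e * (t ^+ k.+1 * k.+1`!%:R).
    rewrite -ler_pdivrMr; last by rewrite mulr_gt0 ?exprn_gt0.
    by rewrite invfM mulrA -expr_div_n he// lerDr.
  rewrite mulrCA /C -mulrA ler_wpM2l ?normal_peak_ge0//.
  rewrite ler_pdivrMr// mulrAC ler_pdivlMr//.
  rewrite [leRHS]mulrC (le_trans _ he)// -exprSr -exprM.
  by rewrite ler_weXn2l// mul2n -addnn leq_addr.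
rewrite [X in _ --> X](_ : 0 = \sum_(i < size p) p`_i * 0); last first.
  by rewrite big1// => i _; rewrite mulr0.
under eq_fun do rewrite horner_coef mulr_suml.
apply: cvg_big => [|i _]; first exact: add_continuous.
under eq_fun do rewrite -mulrA.
by apply: cvgMr; exact: tail.
Unshelve. all: by end_near. Qed.

(* Stein's identity, [- s^2 q(x - c)] times the density being an antiderivative.
   The polynomial ['X q - s^2 q'] is split as [p1 - p2] with [p1, p2 >= 0] so that
   integrability is obtained rather than assumed. *)
Lemma normal_prob_stein (R : realType) (c s : R) (p1 p2 q : {poly R}) :
  s != 0 -> (forall x, 0 <= p1.[x]) -> (forall x, 0 <= p2.[x]) ->
  p1 - p2 = 'X * q - s ^+ 2 *: q^`() ->
  (\int[normal_prob c s]_x (p1.[x - c])%:E =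
   \int[normal_prob c s]_x (p2.[x - c])%:E)%E.
Proof.
move=> s0 p10 p20 e.
have hc (p : {poly R}) : (fun x : R => p.[x - c]) = horner (p \Po ('X - c%:P)).
  by apply/funext => x; rewrite horner_comp hornerXsubC.
have cpc (p : {poly R}) : continuous (fun x : R => p.[x - c]).
  by rewrite hc => x; exact: continuous_horner.
have cpdf (p : {poly R}) : continuous (fun x : R => p.[x - c] * normal_pdf c s x).
  by move=> x; apply: cvgM; [exact: cpc|exact: continuous_normal_pdf].
have mp (p : {poly R}) : measurable_fun setT (fun x : R => p.[x - c]).
  exact: continuous_measurable_fun.
have far (u : nat -> R) : (forall n, `|u n| = n%:R) ->
    `|u n - c| @[n --> \oo] --> +oo.
  move=> un; apply/cvgryPge => A; near=> n.
  rewrite (le_trans _ (lerB_dist _ _))// un lerBrDr.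
  by near: n; exact: nbhs_infty_ger.
rewrite !ge0_integral_normal_prob//.
apply: (@ge0_integral_eq_FTC _ _ _
  (fun x => - s ^+ 2 * (q.[x - c] * normal_pdf c s x))).
- exact: cpdf.
- exact: cpdf.
- by move=> x; rewrite mulr_ge0 ?normal_pdf_ge0.
- by move=> x; rewrite mulr_ge0 ?normal_pdf_ge0.
- move=> x; have dpdf := is_derive_normal_pdf _ c _ x s0.
  have dq : is_derive x (1 : R) (fun x => q.[x - c]) q^`().[x - c].
    rewrite hc; apply: is_derive_eq.
    by rewrite deriv_comp derivXsubC mulr1 horner_comp hornerXsubC.
  apply: is_derive_eq.
  have := congr1 (horner^~ (x - c)) e; rewrite !hornerE => h.
  rewrite -mulrBl h.
  change (- s ^+ 2 * (q.[x - c] * (- ((x - c) / s ^+ 2) * normal_pdf c s x) +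
    normal_pdf c s x * q^`().[x - c]) =
    ((x - c) * q.[x - c] - s ^+ 2 * q^`().[x - c]) * normal_pdf c s x).
  by field.
- rewrite -(mulr0 (- s ^+ 2)); apply: cvgMr; apply: normal_pdf_tail => //.
  by apply: far => n; rewrite normr_nat.
- rewrite -(mulr0 (- s ^+ 2)); apply: cvgMr.
  apply: (normal_pdf_tail _ _ _ _ (fun n => - n%:R)) => //.
  by apply: far => n; rewrite normrN normr_nat.
Unshelve. all: by end_near. Qed.

(* The second integral is a nonnegative substitute for the first moment. *)
Lemma gaussian_law_moments (R : realType) (c s : R)
    (nu : {measure set (measurableTypeR R) -> \bar R}) :
  (forall A, measurable A -> nu A = gaussian_law c s A) ->
  [/\ (\int[nu]_x ((x - c) ^+ 2)%:E = (s ^+ 2)%:E)%E,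
      (\int[nu]_x ((x - c + 1) ^+ 2)%:E = (s ^+ 2 + 1)%:E)%E
    & (\int[nu]_x ((x - c) ^+ 4)%:E = (3 * s ^+ 4)%:E)%E].
Proof.
(* For [s = 0] the law is the Dirac mass at [c], and integration is evaluation at [c]. *)
move=> nuE; have [s0|s0] := eqVneq s 0.
  have E (f : R -> R) : measurable_fun setT f ->
      (\int[nu]_x (f x)%:E = (f c)%:E)%E.
    move=> mf; transitivity (\int[\d_(c : measurableTypeR R)]_x (f x)%:E)%E.
      apply: eq_measure_integral => A mA _.
      by rewrite [LHS]nuE// /gaussian_law s0 eqxx.
    by rewrite integral_dirac//; [rewrite diracT mul1e|exact/measurable_EFinP].
  have mB : measurable_fun [set: R] (fun x : R => x - c) by exact: measurable_funB.
  split; rewrite E ?s0 ?subrr ?expr0n ?mulr0 ?add0r ?expr1n//.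
  - exact: measurable_funX.
  - by apply: measurable_funX; exact: measurable_funD.
  - exact: measurable_funX.
have E (f : R -> R) : (\int[nu]_x (f x)%:E = \int[normal_prob c s]_x (f x)%:E)%E.
  apply: eq_measure_integral => A mA _.
  by rewrite [LHS]nuE// /gaussian_law (negbTE s0).
have Ic r : (\int[normal_prob c s]_x r%:E = r%:E)%E.
  rewrite integral_cst//= [X in (_ * X)%E](@probability_setT _ _ _ (normal_prob c s)).
  by rewrite mule1.
(* Three choices of [q] follow: ['X] gives [X^2 - s^2], ['X + 2] gives [(X + 1)^2 - (s^2 + 1)], and
   ['X ^+ 3] gives [X^4 - 3 s^2 X^2], which reduces the fourth moment to the second. *)
have stein (p1 p2 q : {poly R}) (f1 f2 : R -> R) :
    horner p1 =1 f1 -> horner p2 =1 f2 ->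
    (forall x, 0 <= f1 x) -> (forall x, 0 <= f2 x) ->
    p1 - p2 = 'X * q - s ^+ 2 *: q^`() ->
    (\int[normal_prob c s]_x (f1 (x - c))%:E =
     \int[normal_prob c s]_x (f2 (x - c))%:E)%E.
  move=> /funext<- /funext<- f10 f20; exact: normal_prob_stein.
have m2 : (\int[normal_prob c s]_x ((x - c) ^+ 2)%:E = (s ^+ 2)%:E)%E.
  rewrite (stein ('X ^+ 2) (s ^+ 2)%:P 'X (fun u => u ^+ 2) (cst (s ^+ 2)))//=.
  - by move=> x; rewrite hornerXn.
  - by move=> x; rewrite hornerC.
  - by move=> x; exact: sqr_ge0.
  - by move=> x; exact: sqr_ge0.
  - by rewrite derivX expr2 -mul_polyC mulr1.
split; rewrite E//.
- rewrite (stein (('X + 1) ^+ 2) (s ^+ 2 + 1)%:P ('X + 2%:P)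
    (fun u => (u + 1) ^+ 2) (cst (s ^+ 2 + 1)))//=.
  + by move=> x; rewrite horner_exp hornerD hornerX hornerC.
  + by move=> x; rewrite hornerC.
  + by move=> x; exact: sqr_ge0.
  + by move=> x; rewrite addr_ge0 ?sqr_ge0.
  + by rewrite derivD derivX derivC addr0 -mul_polyC mulr1 !polyCD; ring.
- rewrite (stein ('X ^+ 4) ((3 * s ^+ 2) *: 'X ^+ 2) ('X ^+ 3)
    (fun u => u ^+ 4) (fun u => 3 * s ^+ 2 * u ^+ 2))//=.
  + under eq_integral do rewrite EFinM.
    rewrite ge0_integralZl//=.
    * by rewrite m2 -EFinM -mulrA -exprD.
    * apply/measurable_EFinP/measurable_funX; exact: measurable_funB.
    * by move=> x _; rewrite lee_fin sqr_ge0.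
    * by rewrite lee_fin mulr_ge0 ?sqr_ge0.
  + by move=> x; rewrite hornerXn.
  + by move=> x; rewrite hornerZ hornerXn.
  + by move=> x; rewrite exprn_even_ge0.
  + by move=> x; rewrite mulr_ge0 ?sqr_ge0// mulr_ge0 ?sqr_ge0.
  + by rewrite derivXn [3 * _]mulrC -scalerA scaler_nat -exprS.
Qed.

(** * Moments of the standardized scores [zeta] *)

(** The parameters [c] and [s] of the law are only known to exist; computing the mean and the
    variance from the law identifies [c] with [mu] and [s ^+ 2] with [v]. *)
Lemma gaussian_rv_moments (R : realType) (d : measure_display)
    (T : measurableType d) (P : probability T R) (Y : T -> R) (mu v : R) :
  gaussian_rv P Y -> 'E_P[Y]%E = mu%:E -> covariance P Y Y = v%:E ->
  (\int[P]_w ((Y w - mu) ^+ 2)%:E = v%:E)%E /\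
  (\int[P]_w ((Y w - mu) ^+ 4)%:E = (3 * v ^+ 2)%:E)%E.
Proof.
move=> [mY [c [s law]]] EY covY.
have var : (\int[P]_w ((Y w - mu) ^+ 2)%:E = v%:E)%E.
  rewrite -covY covariance.unlock EY/= unlock.
  by apply: eq_integral => w _; rewrite expr2.
pose nu : {measure set (measurableTypeR R) -> \bar R} := distribution P
  (@mfun_Sub _ _ T (measurableTypeR R) Y (mem_set mY)).
have nuE A : measurable A -> nu A = gaussian_law c s A by exact: law.
have int_nu (f : R -> R) : measurable_fun setT f -> (forall x, 0 <= f x) ->
    (\int[nu]_x (f x)%:E = \int[P]_w (f (Y w))%:E)%E.
  move=> mf f0; rewrite ge0_integral_distribution//; exact/measurable_EFinP.
have [m2 m2' m4] := gaussian_law_moments R c s nu nuE.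
have mB : measurable_fun [set: R] (fun x : R => x - c) by exact: measurable_funB.
have mX n : measurable_fun [set: R] (fun x : R => (x - c) ^+ n).
  exact: measurable_funX.
have m1X n : measurable_fun [set: R] (fun x : R => (x - c + 1) ^+ n).
  by apply: measurable_funX; exact: measurable_funD.
rewrite int_nu// in m2; last by move=> x; exact: sqr_ge0.
rewrite int_nu// in m2'; last by move=> x; exact: sqr_ge0.
rewrite int_nu// in m4; last by move=> x; exact: exprn_even_ge0.
have int_ge0 (f : T -> R) r : measurable_fun setT f -> (forall w, 0 <= f w) ->
    (\int[P]_w (f w)%:E = r%:E)%E -> P.-integrable setT (EFin \o f).
  move=> mf f0 fr; apply/integrableP; split; first exact/measurable_EFinP.
  under eq_integral do rewrite /= ger0_norm//.
  by rewrite fr ltry.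
have i2 : P.-integrable setT (EFin \o (fun w => (Y w - c) ^+ 2)).
  apply: (int_ge0 _ _ _ _ m2); last by move=> w; exact: sqr_ge0.
  exact: (measurableT_comp (mX 2%N)).
have i2' : P.-integrable setT (EFin \o (fun w => (Y w - c + 1) ^+ 2)).
  apply: (int_ge0 _ _ _ _ m2'); last by move=> w; exact: sqr_ge0.
  exact: (measurableT_comp (m1X 2%N)).
have i0 : P.-integrable setT (EFin \o (fun w => 2 * c - 1)).
  exact: finite_measure_integrable_cst.
(* The mean is recovered from two integrable squares: [2 Y = (Y - c + 1)^2 - (Y - c)^2 + (2 c - 1)],
   whose expectation is [(s^2 + 1) - s^2 + 2 c - 1 = 2 c]. *)
have cmu : c = mu.
  apply: EFin_inj; rewrite -EY unlock.
  under eq_integral => w _.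
    have -> : (Y w)%:E = (2^-1%:E * (((Y w - c + 1) ^+ 2)%:E -
        ((Y w - c) ^+ 2)%:E + (2 * c - 1)%:E))%E.
      by rewrite -EFinB -EFinD -EFinM; congr (_%:E); field.
    over.
  rewrite integralZl//=; last first.
    by apply: (integrableD measurableT _ i0); exact: (integrableB measurableT i2' i2).
  rewrite integralD//=; last exact: (integrableB measurableT i2' i2).
  rewrite (integralB measurableT i2' i2)/= m2 m2' integral_cst//= probability_setT.
  by rewrite mule1 -EFinB -EFinD -EFinM; congr (_%:E); field.
(* The sign of [s] stays undetermined, but the fourth moment depends on [s ^+ 2] only. *)
have vs : s ^+ 2 = v by apply: EFin_inj; rewrite -var -m2 cmu.
by split => //; rewrite -cmu m4 -vs -exprM.
Qed.

Lemma innerBl (R : realType) (f g h : L2 R) :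
  inner (f - g) h = inner f h - inner g h.
Proof. by rewrite -scaleN1r innerDl innerZl mulN1r. Qed.

(** Lets the eigenvalue equation for [K], which holds only almost everywhere, be used inside an
    inner product. *)
Lemma inner_aeqE (R : realType) (f f' g : L2 R) :
  (f : R -> R) = f' %[ae lebesgue01 R] -> inner f g = inner f' g.
Proof.
move=> ff'; rewrite /inner /Rintegral; congr fine.
have mfg (h : L2 R) : measurable_fun setT (fun x => (h x * g x)%:E).
  exact: measurable_int _ (inner_integrable h g).
apply: ae_eq_integral => //.
have [N [mN N0 sN]] := ff'; exists N; split => //.
by apply: subset_trans sN; apply: subsetC => x /= ffx _; rewrite ffx.
Qed.

(** The variance of the coordinate of [X l] along [gamma j] is the inner product of [K (gamma j)]
    with [gamma j], that is [lambda j]; dividing by its square root normalizes it to 1. *)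
Lemma zeta_moments (R : realType) (d : measure_display)
    (T : measurableType d) (P : probability T R) (K : L2 R -> L2 R)
    (gamma : nat -> L2 R) (lambda : nat -> R) (m : 'I_2 -> L2 R)
    (X : 'I_2 -> T -> L2 R) (l : 'I_2) (j : nat) :
  gaussian_element P (X l) (m l) K -> orthonormal_basis gamma ->
  (K (gamma j) : R -> R) = (lambda j *: gamma j : L2 R) %[ae lebesgue01 R] ->
  0 < lambda j ->
  [/\ measurable_fun setT (zeta gamma lambda m X l j),
      (\int[P]_w (zeta gamma lambda m X l j w ^+ 2)%:E = 1)%E
    & (\int[P]_w (zeta gamma lambda m X l j w ^+ 4)%:E = 3%:E)%E].
Proof.
move=> [gX mX cX] [og _] eig lam0.
have vX := cX (gamma j) (gamma j).
rewrite (inner_aeqE _ _ _ _ eig) innerZl og eqxx mulr1 in vX.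
have [m2 m4] := gaussian_rv_moments _ _ _ _ _ _ _ (gX _) (mX _) vX.
have [mY _] := gX (gamma j).
have zE w : zeta gamma lambda m X l j w =
    (inner (X l w) (gamma j) - inner (m l) (gamma j)) / Num.sqrt (lambda j).
  by rewrite /zeta innerBl.
have mB : measurable_fun setT (fun w => inner (X l w) (gamma j) -
    inner (m l) (gamma j)) by exact: measurable_funB.
have s2 : Num.sqrt (lambda j) ^+ 2 = lambda j by rewrite sqr_sqrtr ?ltW.
split.
- rewrite (funext zE).
  exact: measurable_funM.
- under eq_integral do rewrite zE expr_div_n s2 mulrC EFinM.
  rewrite ge0_integralZl//=.
  + by rewrite m2 -EFinM mulVf ?gt_eqF.
  + by apply/measurable_EFinP; exact: measurable_funX.
  + by move=> w _; rewrite lee_fin sqr_ge0.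
  + by rewrite lee_fin invr_ge0 ltW.
- under eq_integral do rewrite zE expr_div_n (exprM (Num.sqrt _) 2 2) s2 mulrC EFinM.
  rewrite ge0_integralZl//=.
  + by rewrite m4 -EFinM mulrCA mulVf ?mulr1// expf_neq0// gt_eqF.
  + by apply/measurable_EFinP; exact: measurable_funX.
  + by move=> w _; rewrite lee_fin exprn_even_ge0.
  + by rewrite lee_fin invr_ge0 sqr_ge0.
Qed.

(** Since [a >= 0], the expanded square has nonnegative terms and integrates termwise. The form
    [3 + (2 * a + a ^+ 2)] isolates the part shared with [(1 + a)^2 = 1 + (2 a + a^2)]. *)
Lemma expectation_shifted_square (R : realType) (d : measure_display)
    (T : measurableType d) (P : probability T R) (Z : T -> R) (a : R) :
  measurable_fun setT Z -> 0 <= a ->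
  (\int[P]_w (Z w ^+ 2)%:E = 1)%E -> (\int[P]_w (Z w ^+ 4)%:E = 3%:E)%E ->
  'E_P[(fun w => Z w ^+ 2 + a)%R]%E = (1 + a)%:E /\
  'E_P[(fun w => (Z w ^+ 2 + a) ^+ 2)%R]%E = (3 + (2 * a + a ^+ 2))%:E.
Proof.
move=> mZ a0 m2 m4.
have mX n : measurable_fun setT (fun w => (Z w ^+ n)%:E).
  by apply/measurable_EFinP; exact: measurable_funX.
have Ic r : (\int[P]_w r%:E = r%:E)%E.
  by rewrite integral_cst//= probability_setT mule1.
split; rewrite unlock.
  under eq_integral do rewrite EFinD.
  by rewrite ge0_integralD//= ?m2 ?Ic// => w _; rewrite lee_fin sqr_ge0.
under eq_integral => w _.
  rewrite (_ : (Z w ^+ 2 + a) ^+ 2 = Z w ^+ 4 + (2 * a * Z w ^+ 2 + a ^+ 2)); last ring.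
  rewrite !EFinD (EFinM (2 * a)); over.
have a20 : 0 <= 2 * a by rewrite mulr_ge0.
have mM : measurable_fun setT (fun w => ((2 * a)%:E * (Z w ^+ 2)%:E)%E).
  by apply: emeasurable_funM.
rewrite ge0_integralD//=; last 3 first.
- by move=> w _; rewrite lee_fin exprn_even_ge0.
- by move=> w _; rewrite adde_ge0 ?mule_ge0 ?lee_fin ?sqr_ge0.
- exact: emeasurable_funD.
rewrite ge0_integralD//=; last 2 first.
- by move=> w _; rewrite mule_ge0 ?lee_fin ?sqr_ge0.
- by move=> w _; rewrite lee_fin sqr_ge0.
rewrite ge0_integralZl//=; last by move=> w _; rewrite lee_fin sqr_ge0.
by rewrite m2 m4 Ic mule1.
Qed.

(** * Divergence of the common partial sums and the limit of the ratio *)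

(** The ratio equals [1 + (a - b) / (b + u n)] as soon as [b + u n] is positive, which happens
    eventually. *)
Lemma cvg_ratio_pinfty (R : realType) (u : nat -> R) (a b : R) :
  u n @[n --> \oo] --> +oo -> (a + u n) / (b + u n) @[n --> \oo] --> (1 : R).
Proof.
move=> uy.
have vy : b + u n @[n --> \oo] --> +oo.
  apply/cvgryPge => A; near=> n; rewrite -lerBlDl.
  by near: n; move/cvgryPge : uy; apply.
have v0 : \forall n \near \oo, 0 < b + u n by exact: (cvgryPgt _).1.
have : 1 + (a - b) * (b + u n)^-1 @[n --> \oo] --> 1 + (a - b) * 0.
  apply: cvgD; first exact: cvg_cst.
  by apply: cvgMr; apply/gtr0_cvgV0.
rewrite mulr0 addr0; apply: cvg_trans; apply: near_eq_cvg; near=> n.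
have : 0 < b + u n by near: n; exact: v0.
by move=> /lt0r_neq0 bu0; field.
Unshelve. all: by end_near. Qed.

Theorem theorem3p5 (R : realType) (d : measure_display)
    (T : measurableType d) (P : probability T R)
    (k : R -> R -> R) (K : L2 R -> L2 R)
    (gamma : nat -> L2 R) (lambda : nat -> R)
    (m : 'I_2 -> L2 R) (X : 'I_2 -> T -> L2 R) (alpha : R)
    (hk : covariance_kernel k) (hKk : induced_by K k)
    (hKsym : self_adjoint K) (hKpos : positive_op K) (hKtr : trace_class K)
    (hX : forall l, gaussian_element P (X l) (m l) K)
    (hgamma : orthonormal_basis gamma)
    (heig : forall j, (K (gamma j) : R -> R) = (lambda j *: gamma j : L2 R)
                      %[ae lebesgue01 R])
    (hlambda_dec : forall i j, (i <= j)%N -> lambda j <= lambda i)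
    (hlambda_gt0 : forall j, 0 < lambda j)
    (halpha : 0 < alpha < 1)
    (hCM : ~ cameron_martin gamma lambda (mean_diff m)) :
  A4 P gamma lambda m X alpha q / AF P gamma lambda m X alpha q
    @[q --> \oo] --> (1 : R).
Proof.
have [alpha0 alpha1] := andP halpha.
pose nu2 j := nu_tilde gamma lambda m j ^+ 2.
pose b l j := acoef alpha l ^+ 2 * nu2 j.
pose t j := \sum_(l < 2) prior alpha l * (2 * b l j + b l j ^+ 2).
(* Weights of total mass 1 let the constants 3 and 1 be moved inside the mixture and split off from
   [t j]. *)
have prior1 : \sum_(l < 2) prior alpha l = 1.
  by rewrite !big_ord_recl big_ord0 /prior/= addr0 addrC subrK.
have b0 l j : 0 <= b l j by rewrite mulr_ge0 ?sqr_ge0.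
have mom l j := zeta_moments _ _ _ _ _ _ _ _ _ _ _ (hX l) hgamma (heig j) (hlambda_gt0 j).
have kE q (j : 'I_q) : kappa P gamma lambda m X alpha j = 3 + t j.
  rewrite kappaE// (_ : 3 = \sum_(l < 2) prior alpha l * 3); last first.
    by rewrite -mulr_suml prior1 mul1r.
  rewrite -big_split; apply: eq_bigr => l _.
  have [mZ m2 m4] := mom l j.
  have [_ ->] := expectation_shifted_square _ _ _ _ _ _ mZ (b0 l j) m2 m4.
  by rewrite /=; ring.
have kFE q (j : 'I_q) : kappaF P gamma lambda m X alpha j = 1 + t j.
  rewrite kappaFE// -prior1 -big_split; apply: eq_bigr => l _.
  have [mZ m2 m4] := mom l j.
  have [-> _] := expectation_shifted_square _ _ _ _ _ _ mZ (b0 l j) m2 m4.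
  by rewrite /=; ring.
have A4E q : A4 P gamma lambda m X alpha q = 3 + series t q.
  rewrite /A4 seriesEord; congr (_ + _); apply: eq_bigr => j _.
  by rewrite kE addrC addKr.
have AFE q : AF P gamma lambda m X alpha q = 1 + series t q.
  rewrite /AF seriesEord; congr (_ + _); apply: eq_bigr => j _.
  by rewrite kFE addrC addKr.
under eq_fun do rewrite A4E AFE.
apply: cvg_ratio_pinfty.
pose rho := alpha * (1 - alpha).
have rho0 : 0 < 2 * rho by rewrite !mulr_gt0 ?subr_gt0.
(* The linear part of [t j] is exactly [2 rho nu2 j], because [alpha (1 - alpha)^2 + (1 - alpha)
   alpha^2 = rho]; the remaining squares are nonnegative. *)
have le_t j : 2 * rho * nu2 j <= t j.
  have -> : t j = 2 * rho * nu2 j + \sum_(l < 2) prior alpha l * b l j ^+ 2.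
    by rewrite /t !big_ord_recl !big_ord0 /b /prior /acoef /rho/=; ring.
  rewrite lerDl sumr_ge0// => l _; rewrite mulr_ge0 ?sqr_ge0// /prior.
  by case: ifP => _; rewrite ltW// subr_gt0.
have nu2E : series nu2 =
    series (fun j => inner (mean_diff m) (gamma j) ^+ 2 / lambda j).
  congr series; apply/funext => j.
  by rewrite /nu2 /nu_tilde expr_div_n sqr_sqrtr ?ltW.
(* Partial sums of nonnegative terms are nondecreasing, so failing to converge, which is [hCM] read
   through [nu2E], means tending to infinity. *)
have nu2y : series nu2 n @[n --> \oo] --> +oo.
  apply: nondecreasing_dvgn_lt.
    by apply: nondecreasing_series => j _ _; exact: sqr_ge0.
  by rewrite nu2E.
apply/cvgryPge => A; near=> n.
apply: (@le_trans _ _ (2 * rho * series nu2 n)).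
  rewrite -ler_pdivrMl//.
  by near: n; move/cvgryPge : nu2y; apply.
by rewrite !seriesEord/= mulr_sumr; apply: ler_sum.
Unshelve. all: by end_near. Qed.
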